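(* Let $A$ be a finite set with $|A|\ge 2$. For a transformation $\phi$ of $[n]$ ($n\ge2$) which is not a permutation, let $R(\phi)$ denote the ratio of the procedural complexity $\mathcal{L}(f^\phi)$ of $f^\phi:A^n\to A^n$ over the minimum length of a black box program computing $f^\phi$. Then $R(\phi)>2/3$ for every $n\ge 2$ and every $\phi:[n]\to[n]$ which is not a permutation. Conversely, for every $\epsilon>0$ there exist $n$ and a non-permutation $\phi:[n]\to[n]$ such that $R(\phi)<2/3+\epsilon$.
   Context: $[n]=\{1,\dots,n\}$; the image of $i$ under $\phi:[n]\to[n]$ is written $i\phi$. The manipulation of variables induced by $\phi$ is $f^\phi:A^n\to A^n$, $f^\phi(x_1,\dots,x_n)=(x_{1\phi},\dots,x_{n\phi})$. A transformation of $A^n$ is a map $f=(f_1,\dots,f_n):A^n\to A^n$; its coordinate function $f_i:A^n\to A$ is trivial if $f_i(x)=x_i$ for all $x$. An instruction is a transformation of $A^n$ with at most one nontrivial coordinate function. A program of length $L$ computing $f$ is a sequence of instructions $g^1,\dots,g^L$ with $f=g^L\circ\cdots\circ g^1$. The procedural complexity $\mathcal{L}(f)$ is the shortest length of a program computing $f$; the identity has procedural complexity $0$. A black box instruction is an instruction of the form $y_i\gets y_j$ for some $i,j\in[n]$, i.e. it replaces the $i$-th coordinate of the current tuple $y\in A^n$ by its $j$-th coordinate and leaves all other coordinates unchanged. A black box program is a program all of whose instructions are black box instructions (when $\phi$ is not a permutation, $f^\phi$ can always be computed by such a program). *)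

(* Defs.v *)
From mathcomp Require Import all_boot all_order all_algebra.
From mathcomp Require Import boolp classical_sets reals.

Set Implicit Arguments.
Unset Strict Implicit.
Unset Printing Implicit Defensive.

Import Order.TTheory GRing.Theory Num.Theory.
Local Open Scope ring_scope.

(* A^n is {ffun 'I_n -> A}, with [n] = {1, ..., n} shifted to {0, ..., n-1}. *)
Definition transf (A : finType) (n : nat) : Type :=
  {ffun 'I_n -> A} -> {ffun 'I_n -> A}.

Definition manip (A : finType) (n : nat) (phi : 'I_n -> 'I_n) : transf A n :=
  fun x => [ffun i => x (phi i)].

Definition trivial_coord (A : finType) (n : nat) (f : transf A n) (i : 'I_n) :
    bool :=
  [forall x, f x i == x i].

Definition instruction (A : finType) (n : nat) (f : transf A n) : bool :=
  (#|[set i | ~~ trivial_coord f i]| <= 1)%N.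

Definition assign (A : finType) (n : nat) (i j : 'I_n) : transf A n :=
  fun y => [ffun k => if k == i then y j else y k].

Definition black_box (A : finType) (n : nat) (f : transf A n) : bool :=
  [exists i, exists j, [forall y, f y == assign i j y]].

Lemma black_box_instruction (A : finType) (n : nat) (f : transf A n) :
  black_box f -> instruction f.
Proof.
case/existsP=> i /existsP[j /forallP fE].
rewrite /instruction -(cards1 i); apply/subset_leq_card/fintype.subsetP => k.
rewrite !inE; apply: contraR => ki; apply/forallP => y.
by rewrite (eqP (fE y)) ffunE (negbTE ki).
Qed.

(* The head of the sequence is executed first: running [:: g1; ...; gL] is
   the composite gL o ... o g1, and the empty program is the identity. *)
Definition run (A : finType) (n : nat) (p : seq (transf A n)) : transf A n :=
  fun x => foldl (fun y g => g y) x p.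

Definition computable_in (A : finType) (n : nat) (I : pred (transf A n))
    (f : transf A n) (L : nat) : Prop :=
  exists p : seq (transf A n), [/\ size p = L, all I p & run p =1 f].

(* Shortest length of a program for f with all instructions in I; the junk
   value is 0 when there is no such program. *)
Definition shortest (A : finType) (n : nat) (I : pred (transf A n))
    (f : transf A n) : nat :=
  xget 0%N [set L | computable_in I f L /\
                    forall k, computable_in I f k -> (L <= k)%N]%classic.

Lemma shortestP (A : finType) (n : nat) (I : pred (transf A n))
    (f : transf A n) (L0 : nat) :
  computable_in I f L0 ->
  computable_in I f (shortest I f) /\
  forall k, computable_in I f k -> (shortest I f <= k)%N.
Proof.
move=> fL0; have exL : exists L, `[< computable_in I f L >].
  by exists L0; apply/asboolP.
case: (ex_minnP exL) => m /asboolP fm minm.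
rewrite /shortest; case: xgetP => [_ _ //|/(_ m)[]].
by split=> // k fk; apply/minm/asboolP.
Qed.

Definition procedural_complexity (A : finType) (n : nat) (f : transf A n) :
    nat :=
  shortest (@instruction A n) f.

Definition black_box_complexity (A : finType) (n : nat) (f : transf A n) :
    nat :=
  shortest (@black_box A n) f.

(* Since x / 0 = 0, a positive lower bound on the ratio also excludes the junk
   value of [shortest] in both the numerator and the denominator. *)
Definition complexity_ratio (R : realType) (A : finType) (n : nat)
    (phi : 'I_n -> 'I_n) : R :=
  (procedural_complexity (manip (A := A) phi))%:R /
  (black_box_complexity (manip (A := A) phi))%:R.

Arguments complexity_ratio R A {n} phi.

(* Main.v *)
(** Let [D] be the number of points moved by [phi].  Each moved coordinate has to
    be updated, so [L(f^phi) >= D].  Conversely, when [phi] is not surjective some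
    coordinate is free to serve as scratch space, and then either one black box
    instruction decreases [D] by one, or three of them decrease it by two, always
    leaving a non-surjective map; this gives a black box program of length less
    than [3 D / 2].

    The constant is sharp for [m] disjoint transpositions together with one
    coordinate that is merely overwritten by a fixed one.  Storing there the sum
    (for any group law on [A]) of one element of each pair allows all pairs to be
    swapped with two instructions each, hence [L <= 2 m + 2], whereas a black box
    program has to duplicate a value of each pair before touching that pair, hence
    needs at least [3 m] instructions. *)
Require Import Defs.
From mathcomp Require Import all_boot all_order all_algebra.
From mathcomp Require Import boolp reals.
From mathcomp Require Import zify lra.

Set Implicit Arguments.
Unset Strict Implicit.
Unset Printing Implicit Defensive.

Import Order.TTheory GRing.Theory Num.Theory.
Local Open Scope ring_scope.

(** * Moved coordinates and the length of arbitrary programs *)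

Definition moved (n : nat) (phi : 'I_n -> 'I_n) : {set 'I_n} :=
  [set i | phi i != i].

Lemma not_bijective_nonsurj (n : nat) (phi : 'I_n -> 'I_n) :
  ~ bijective phi -> exists i, forall j, phi j != i.
Proof.
move=> phiNbij; have [/existsP[i /forallP iP]|] := boolP [exists i, forall j, phi j != i].
  by exists i.
rewrite negb_exists => /forallP surj; case: phiNbij.
have pre i : exists j, phi j == i.
  by have := surj i; rewrite negb_forall => /existsP[j]; rewrite negbK; exists j.
have gK : cancel (fun i => xchoose (pre i)) phi.
  by move=> i; apply/eqP/(xchooseP (pre i)).
by exists (fun i => xchoose (pre i)) => //; apply: canF_sym.
Qed.

(** A tuple marking the single coordinate [phi i] by a second letter reveals where coordinate [i]
    reads from. *)
Lemma manip_inj (A : finType) (n : nat) (phi psi : 'I_n -> 'I_n) :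
  (2 <= #|A|)%N -> manip (A := A) phi =1 manip psi -> phi =1 psi.
Proof.
move=> /card_gt1P[a [b [_ _ ab]]] eq_manip i.
have /(congr1 (fun f : {ffun 'I_n -> A} => f i)) :=
  eq_manip [ffun j => if j == phi i then a else b].
rewrite !ffunE eqxx; case: eqVneq => [-> //|_ eq_ab].
by rewrite eq_ab eqxx in ab.
Qed.

Lemma run_trivial_coord (A : finType) (n : nat) (p : seq (transf A n)) i x :
  all (fun g => trivial_coord g i) p -> run p x i = x i.
Proof.
rewrite /run; elim: p x => //= g p IHp x /andP[/forallP gi pi].
by rewrite IHp // (eqP (gi x)).
Qed.

(** A coordinate trivial in every instruction never changes, so [phi] fixes it; thus the nontrivial
    coordinates, at most one per instruction, cover [moved phi]. *)
Lemma moved_le_program (A : finType) (n : nat) (phi : 'I_n -> 'I_n) (L : nat) :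
  (2 <= #|A|)%N ->
  computable_in (@instruction A n) (manip phi) L -> (#|moved phi| <= L)%N.
Proof.
move=> hA [p [<- p_instr run_p]].
pose nontriv g := [set i | ~~ @trivial_coord A n g i].
have sub : moved phi \subset \bigcup_(g <- p) nontriv g.
  apply/subsetP => i; rewrite inE; apply: contraR => iP.
  have i_triv : all (fun g => trivial_coord g i) p.
    elim: (p) iP => //= g q IHq; rewrite big_cons !inE negb_or negbK.
    by case/andP=> -> /IHq.
  have eq_manip :
      manip (A := A) phi =1 manip (fun j => if j == i then i else phi j).
    move=> x; apply/ffunP => j; rewrite !ffunE; case: eqP => // ->.
    by rewrite -(run_trivial_coord x i_triv) run_p ffunE.
  by rewrite (manip_inj hA eq_manip) eqxx.
apply: leq_trans (subset_leq_card sub) _.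
elim: p p_instr {run_p sub} => [|g p IHp] /=; first by rewrite big_nil cards0.
case/andP=> g_instr /IHp le_p; rewrite big_cons -add1n.
by apply: leq_trans (leq_card_setU _ _) (leq_add g_instr le_p).
Qed.

(** * Black box programs as compositions of index maps *)

Definition redirect (n : nat) (i j k : 'I_n) : 'I_n := if k == i then j else k.

Lemma manip_redirect (A : finType) (n : nat) (i j : 'I_n) (y : {ffun 'I_n -> A}) :
  manip (redirect i j) y = assign i j y.
Proof. by apply/ffunP => k; rewrite !ffunE /redirect; case: eqP. Qed.

(* The map [psi] such that the program [y_i <- y_j], [(i, j)] ranging over [ps],
   computes [f^psi]. *)
Definition wiring (n : nat) (ps : seq ('I_n * 'I_n)) : 'I_n -> 'I_n :=
  foldr (fun ij psi => redirect ij.1 ij.2 \o psi) id ps.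

(** [manip] reverses composition, so the instruction run first is the outermost index map. *)
Lemma run_assign (A : finType) (n : nat) (ps : seq ('I_n * 'I_n)) :
  run [seq @assign A n ij.1 ij.2 | ij <- ps] =1 manip (wiring ps).
Proof.
rewrite /run; elim: ps => [|[i j] ps IHps] x /=; first by apply/ffunP => k; rewrite !ffunE.
by rewrite IHps -manip_redirect; apply/ffunP => k; rewrite !ffunE.
Qed.

Lemma black_box_assign (A : finType) (n : nat) (i j : 'I_n) :
  black_box (@assign A n i j).
Proof. by apply/existsP; exists i; apply/existsP; exists j; apply/forallP. Qed.

Lemma computable_black_boxP (A : finType) (n : nat) (phi : 'I_n -> 'I_n) (L : nat) :
  (2 <= #|A|)%N ->
  computable_in (@black_box A n) (manip phi) L <->
  exists2 ps : seq ('I_n * 'I_n), size ps = L & wiring ps =1 phi.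
Proof.
move=> hA; split=> [[p [<- p_bb run_p]]|[ps <- psE]]; last first.
  exists [seq @assign A n ij.1 ij.2 | ij <- ps]; split; first by rewrite size_map.
    by rewrite all_map; apply/allP => ij _; apply: black_box_assign.
  by move=> x; rewrite run_assign; apply/ffunP => i; rewrite !ffunE psE.
have [ps [size_ps run_ps]] : exists ps : seq ('I_n * 'I_n),
    size ps = size p /\ run [seq @assign A n ij.1 ij.2 | ij <- ps] =1 run p.
  elim: p p_bb {run_p} => [|g p IHp] /=; first by exists [::].
  case/andP=> /existsP[i /existsP[j /forallP gE]] /IHp[ps [size_ps run_ps]].
  exists ((i, j) :: ps); split=> [/=|x]; first by rewrite size_ps.
  by have := run_ps (g x); rewrite /run /= (eqP (gE x)).
exists ps => //; apply: (manip_inj hA) => x.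
by rewrite -run_assign run_ps run_p.
Qed.

(** * Short black box programs for non-surjective maps *)

Lemma moved_lt (n : nat) (phi rho : 'I_n -> 'I_n) (i : 'I_n) :
  phi i != i -> rho i = i -> (forall j, phi j = j -> rho j = j) ->
  (#|moved rho| < #|moved phi|)%N.
Proof.
move=> phii rhoi fixP; apply: proper_card; apply/properP; split.
  by apply/subsetP => j; rewrite !inE; apply: contraNN => /eqP/fixP->.
by exists i; rewrite !inE ?rhoi ?eqxx.
Qed.

Lemma moved_lt2 (n : nat) (phi rho : 'I_n -> 'I_n) (i k : 'I_n) :
  i != k -> phi i != i -> phi k != k -> rho i = i -> rho k = k ->
  (forall j, phi j = j -> rho j = j) -> (#|moved rho| + 2 <= #|moved phi|)%N.
Proof.
move=> ik phii phik rhoi rhok fixP.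
pose mid j := if j == i then i else phi j.
have midk : mid k != k by rewrite /mid [k == i]eq_sym (negPf ik).
have lt1 : (#|moved mid| < #|moved phi|)%N.
  by apply: (@moved_lt _ _ _ i) => //; rewrite /mid ?eqxx // => j; case: eqP.
have lt2 : (#|moved rho| < #|moved mid|)%N.
  apply: (@moved_lt _ _ _ k) => // j; rewrite /mid; case: eqP => [->//|_].
  exact: fixP.
lia.
Qed.

(* The free coordinate [i] receives [x_(phi i)]; if [phi i] is moved, everyone
   else reads it from [i], which frees the coordinate [phi i]. *)
Lemma one_step (n : nat) (phi : 'I_n -> 'I_n) (i : 'I_n) :
  (forall j, phi j != i) -> phi (phi i) != phi i ->
  exists rho : 'I_n -> 'I_n,
    [/\ forall j, redirect i (phi i) (rho j) = phi j,
        (#|moved rho| < #|moved phi|)%N & exists k, forall j, rho j != k].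
Proof.
move=> free phiphi; have phii := free i.
exists (fun j => if phi j == phi i then i else phi j); split.
- move=> j; rewrite /redirect; case: (eqVneq (phi j)) => [->|_]; rewrite ?eqxx //.
  by rewrite (negPf (free j)).
- apply: (@moved_lt _ _ _ i); rewrite ?eqxx // => j phij; rewrite phij.
  by case: eqP => // jE; rewrite -jE phij eqxx in phiphi.
- exists (phi i) => j; case: ifP => [_|-> //]; by rewrite eq_sym.
Qed.

(* A cycle of length at least two through [k] is opened by saving [x_k] in the
   free coordinate [i]; then [k] and [phi k] receive their final values. *)
Lemma three_steps (n : nat) (phi : 'I_n -> 'I_n) (i k : 'I_n) :
  (forall j, phi j != i) -> phi (phi i) = phi i -> phi k != k -> k != i ->
  {in predC1 i &, injective phi} ->
  exists (rho : 'I_n -> 'I_n) (ps : seq ('I_n * 'I_n)),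
    [/\ size ps = 3, forall j, wiring ps (rho j) = phi j,
        (#|moved rho| + 2 <= #|moved phi|)%N & exists l, forall j, rho j != l].
Proof.
move=> free phiphi phik ki inj.
have injN j j' : j != i -> j' != i -> phi j = phi j' -> j = j' by move=> *; apply: inj.
have phikk : phi (phi k) != phi k.
  by apply: contraNneq phik => /injN ->.
have zk : phi i != k by apply: contraNneq phik => <-; rewrite phiphi.
have zphik : phi i != phi k.
  apply: contraNneq phikk => <-; by rewrite phiphi.
pose l := phi (phi k).
have zl : phi i != l.
  by rewrite -phiphi; apply: contraNneq zphik => /injN ->.
(* For [v != i], after the three instructions [x_v] is found at [sigma v]. If [l = k] the cycle is a
   transposition, and [x_l] has to be fetched from its copy in [i]. *)
pose sigma j := if j == k then i else if j == phi k then k else j.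
pose rho j := if j == k then k else if j == phi k then phi k else sigma (phi j).
exists rho, [:: (i, k); (k, phi k); (phi k, if l == k then i else l)]; split=> //.
- move=> j; rewrite /wiring /= /rho /sigma.
  pose psi v := redirect i k (redirect k (phi k)
    (redirect (phi k) (if l == k then i else l) v)).
  have psii : psi i = k.
    rewrite /psi /redirect [i == phi k]eq_sym (negPf (free k)).
    by rewrite [i == k]eq_sym (negPf ki) eqxx.
  have psik : psi k = phi k.
    by rewrite /psi /redirect [k == phi k]eq_sym (negPf phik) eqxx (negPf (free k)).
  have psil : psi (phi k) = l.
    rewrite /psi [redirect (phi k) _ _]/redirect eqxx; case: (eqVneq l k) => [->|lk].
      by rewrite /redirect [i == k]eq_sym (negPf ki) eqxx.
    by rewrite /redirect (negPf lk) (negPf (free _)).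
  have psiid v : v != i -> v != k -> v != phi k -> psi v = v.
    by rewrite /psi /redirect => vi vk vl; rewrite (negPf vl) (negPf vk) (negPf vi).
  rewrite -/(psi _); case: (eqVneq j k) => [->//|jk].
  case: (eqVneq j (phi k)) => [->//|jl].
  case: (eqVneq (phi j) k) => [->//|pjk].
  by case: (eqVneq (phi j) (phi k)) => [->//|pjl]; apply: psiid.
- apply: (@moved_lt2 _ _ _ k (phi k)) => //.
  + by rewrite eq_sym.
  + by rewrite /rho eqxx.
  + by rewrite /rho (negPf phik) eqxx.
  + move=> j phij; rewrite /rho; case: eqP => [->//|jk]; case: eqP => [->//|jl].
    by rewrite /sigma phij; case: eqP => //; case: eqP.
(* For a transposition, [x_k] has reached its only reader and [i] is free again; for a longer cycle
   [phi k] was the only reader of [l], which becomes free. *)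
- have [lk|lk] := eqVneq l k.
    exists i => j; rewrite /rho; case: (eqVneq j k) => [_ //|jk].
    case: (eqVneq j (phi k)) => [_ //|jl].
    rewrite /sigma; case: (eqVneq (phi j) k) => [phijk|_]; last by case: ifP.
    have ji : j != i by apply: contraNneq zk => <-; rewrite phijk.
    by move/eqP: jl => []; apply: injN => //; rewrite phijk -/l lk.
  exists l => j; rewrite /rho; case: (eqVneq j k) => [_|jk]; first by rewrite eq_sym.
  case: (eqVneq j (phi k)) => [_|jl]; first by rewrite eq_sym.
  rewrite /sigma; case: (eqVneq (phi j) k) => [_|_]; first by rewrite eq_sym free.
  case: (eqVneq (phi j) (phi k)) => [_|_]; first by rewrite eq_sym.
  have [->//|ji] := eqVneq j i.
  by apply: contraNneq jl => /injN ->.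
Qed.

(** Induction on the moved points. Trading three instructions for two points leaves no slack, but a
    free coordinate is itself moved, so the induction must end with a single instruction, which
    gives strictness. *)
Lemma short_wiring (n : nat) (phi : 'I_n -> 'I_n) :
  (exists i, forall j, phi j != i) ->
  exists2 ps : seq ('I_n * 'I_n),
    wiring ps =1 phi & (2 * size ps < 3 * #|moved phi|)%N.
Proof.
have [N] := ubnP #|moved phi|; elim: N phi => // N IHN phi ltN [i free].
have phii := free i.
have [phiphi|phiphi] := eqVneq (phi (phi i)) (phi i); last first.
  have [rho [rhoE lt_rho free_rho]] := one_step free phiphi.
  have [||ps psE le_ps] := IHN rho; [lia | by [] | ].
  exists ((i, phi i) :: ps) => [j /=|]; last by rewrite [size _]/=; lia.
  by rewrite psE rhoE.
pose phi' j := if j == i then i else phi j.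
have phi'E j : redirect i (phi i) (phi' j) = phi j.
  rewrite /phi' /redirect; case: (eqVneq j i) => [->|_]; rewrite ?eqxx //.
  by rewrite (negPf (free j)).
have lt_phi' : (#|moved phi'| < #|moved phi|)%N.
  by apply: (@moved_lt _ _ _ i) => //; rewrite /phi' ?eqxx // => j; case: eqP.
have [/existsP[l /forallP lP]|] := boolP [exists l, forall j, phi' j != l].
  have [||ps psE le_ps] := IHN phi'; [lia | by exists l | ].
  exists ((i, phi i) :: ps) => [j /=|]; last by rewrite [size _]/=; lia.
  by rewrite psE phi'E.
move=> surj; have inj' : injective phi'.
  apply: bij_inj; apply: contrapT => /not_bijective_nonsurj[l lP].
  by case/negP: surj; apply/existsP; exists l; apply/forallP.
have inj : {in predC1 i &, injective phi}.
  move=> j j'; rewrite !inE => /negPf ji /negPf j'i eq_phi; apply: inj'.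
  by rewrite /phi' ji j'i.
(* Here [phi'] is a permutation: filling [i] now would use up the last free coordinate, so
   nontrivial cycles are opened first. *)
have [/existsP[k /andP[ki phik]]|] := boolP [exists k, (k != i) && (phi k != k)].
  have [rho [qs [size_qs qsE le_rho free_rho]]] := three_steps free phiphi phik ki inj.
  have [||ps psE le_ps] := IHN rho; [lia | by [] | ].
  exists (qs ++ ps) => [j|]; last by rewrite size_cat; lia.
  have -> : wiring (qs ++ ps) j = wiring qs (wiring ps j).
    by elim: (qs) => //= q qs' ->.
  by rewrite psE qsE.
rewrite negb_exists => /forallP fixed.
exists [:: (i, phi i)] => [j /=|].
  rewrite /redirect; case: eqP => [->//|/eqP ji].
  by have := fixed j; rewrite ji negbK => /eqP.
have : (0 < #|moved phi|)%N by apply: leq_ltn_trans lt_phi'.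
rewrite [size _]/=; lia.
Qed.

Lemma ratio_gt_two_thirds (R : realType) (A : finType) (n : nat) (phi : 'I_n -> 'I_n) :
  (2 <= #|A|)%N -> ~ bijective phi -> 2%:R / 3%:R < complexity_ratio R A phi.
Proof.
move=> hA /not_bijective_nonsurj/short_wiring[ps psE le_ps].
have /shortestP[bb_min /(_ (size ps)) le_bb] :
    computable_in (@black_box A n) (manip phi) (size ps).
  by apply/computable_black_boxP => //; exists ps.
have {}le_bb : (black_box_complexity (manip (A := A) phi) <= size ps)%N.
  by apply: le_bb; apply/computable_black_boxP => //; exists ps.
have bb_instr : computable_in (@instruction A n) (manip phi)
    (black_box_complexity (manip (A := A) phi)).
  case: bb_min => p [sz p_bb run_p]; exists p; split=> //.
  by apply: sub_all p_bb => g; apply: black_box_instruction.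
have [/(moved_le_program hA) le_D /(_ _ bb_instr) _] := shortestP bb_instr.
have := moved_le_program hA bb_instr.
rewrite /complexity_ratio -/(procedural_complexity _) in le_D *.
set b := black_box_complexity _ in le_bb *; set c := procedural_complexity _ in le_D *.
move=> D_le_b; have b_gt0 : (0 < b)%N by lia.
rewrite ltr_pdivlMr ?ltr0n // mulrAC ltr_pdivrMr ?ltr0n // -!natrM ltr_nat.
lia.
Qed.

(** * Black box lower bound for disjoint transpositions *)

(* [S] contains exactly one point of each transposition. *)
Record pendant_swaps (n : nat) (phi : 'I_n -> 'I_n) (t : 'I_n) (S : {set 'I_n}) :
    Prop := PendantSwaps {
  pendant_notin : t \notin S;
  pendant_image_notin : phi t \notin S;
  pendant_moved : phi t != t;
  pendant_image_fixed : phi (phi t) = phi t;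
  swapsK : forall i, i != t -> phi (phi i) = i;
  swaps_notin : forall r, r \in S -> phi r \notin S;
  swaps_fixed : forall i, i \notin S -> phi i \notin S -> i != t -> phi i = i }.

Lemma swaps_moved (n : nat) (phi : 'I_n -> 'I_n) t S r :
  pendant_swaps phi t S -> r \in S -> [/\ phi (phi r) = r, r != phi r & phi r != t].
Proof.
case=> tS ptS _ pfix K notin _ rS; have rt : r != t by apply: contraNneq tS => <-.
split; first exact: K.
  by apply: contraTneq (rS) => ->; apply: notin.
by apply: contraNneq ptS => <-; rewrite K.
Qed.

(** Shows that a value of a pair is wrong anywhere outside the pair: off [t] the map is an
    involution, and [t] reads a fixed point. *)
Lemma swaps_preimage (n : nat) (phi : 'I_n -> 'I_n) t S r j :
  pendant_swaps phi t S -> r \in S -> phi j \in pred2 r (phi r) ->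
  j \in pred2 r (phi r).
Proof.
move=> H rS; have [pK _ _] := swaps_moved H rS.
case: H => tS ptS pm pfix K notin _; rewrite !inE.
have [->|jt] := eqVneq j t.
  case/orP=> /eqP E; first by rewrite E rS in ptS.
  by have := ptS; rewrite -pfix E pK rS.
by case/orP=> /eqP E; rewrite -(K j jt) E ?pK eqxx ?orbT.
Qed.

Lemma card_moved_swaps (n : nat) (phi : 'I_n -> 'I_n) t S :
  pendant_swaps phi t S -> (2 * #|S| <= #|moved phi|)%N.
Proof.
move=> H; have inj : {in S &, injective phi}.
  move=> r q rS qS E; have [rK _ _] := swaps_moved H rS.
  by have [qK _ _] := swaps_moved H qS; rewrite -rK E qK.
have dis : S :&: phi @: S = set0.
  apply/setP => i; rewrite !inE; apply/negP => /andP[iS /imsetP[r rS iE]].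
  by have := swaps_notin H rS; rewrite -iE iS.
rewrite mul2n -addnn -[X in (_ + X <= _)%N](card_in_imset inj) -cardsUI dis cards0 addn0.
apply/subset_leq_card/subsetP => i; rewrite !inE => /orP[iS|/imsetP[r rS ->]].
  by have [_ ] := swaps_moved H iS; rewrite eq_sym.
by have [-> ] := swaps_moved H rS.
Qed.

(* The values [x_r] and [x_(phi r)] have not been copied anywhere yet. *)
Definition intact (n : nat) (phi psi : 'I_n -> 'I_n) (S : {set 'I_n}) : {set 'I_n} :=
  [set r in S | [forall i, (psi i \in pred2 r (phi r)) ==> (psi i == i)]].

(* Each step decreases the number of wrong coordinates or the number of intact
   pairs, but never both: the first copy of a value of an intact pair has to go
   outside of the pair, where it is wrong. *)
Lemma wiring_swaps_ge (n : nat) (phi psi : 'I_n -> 'I_n) t S ps :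
  pendant_swaps phi t S -> psi \o wiring ps =1 phi ->
  (#|[set i | psi i != phi i]| + #|intact phi psi S| <= size ps + #|intact phi phi S|)%N.
Proof.
move=> H; elim: ps psi => [|[i j] ps IHps] psi psiE /=.
  rewrite add0n; have -> : [set i | psi i != phi i] = set0.
    by apply/setP => i; rewrite !inE -(psiE i) eqxx.
  rewrite cards0 add0n; apply/subset_leq_card/subsetP => r; rewrite !inE.
  case/andP=> -> /forallP rP; apply/forallP => k.
  by have := rP k; rewrite -(psiE k).
(* Coordinate [k] currently holds [x_(psi k)]; running [y_i <- y_j] changes this at [i] alone. *)
pose psi' := psi \o redirect i j.
have psi'N k : k != i -> psi' k = psi k by rewrite /psi' /= /redirect => /negPf ->.
have psi'E : psi' \o wiring ps =1 phi by move=> k; rewrite -(psiE k).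
apply: leq_trans (_ : (_ + #|intact phi psi' S|).+1 <= _)%N; last first.
  by rewrite addSn ltnS; apply: IHps psi'E.
have [sub|/subsetPn[r]] := boolP (intact phi psi S \subset intact phi psi' S).
  rewrite -addSn; apply: leq_add (subset_leq_card sub).
  rewrite -add1n -(cards1 i); apply: leq_trans (leq_card_setU _ _).
  apply/subset_leq_card/subsetP => k; rewrite !inE.
  by case: (eqVneq k i) => //= ki; rewrite psi'N.
rewrite !inE => /andP[rS /forallP rP].
rewrite rS negb_forall => /existsP[k]; rewrite negb_imply => /andP[kr k'].
have ki : k = i.
  apply/eqP; apply: contraNT k' => ki; rewrite psi'N // in kr *.
  exact: implyP (rP k) kr.
rewrite {k}ki in kr k'.
(* Overwriting [i] inside an intact pair would destroy the sole copy of [x_i], which [phi] still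
   reads. *)
have iN : i \notin pred2 r (phi r).
  apply/negP => ir.
  have [q qE] : exists q, psi' q = i.
    have [pK _ _] := swaps_moved H rS.
    case/pred2P: ir => ->; last by exists (wiring ps r); rewrite [LHS]psi'E.
    by exists (wiring ps (phi r)); rewrite [LHS]psi'E.
  have [qi|qi] := eqVneq q i; first by rewrite -{2}qE qi eqxx in k'.
  have := rP q; rewrite -psi'N // qE ir => /eqP iq.
  by rewrite iq eqxx in qi.
have wrong : psi' i != phi i.
  apply: contraNneq iN => E; apply: swaps_preimage H rS _; by rewrite -E.
(* No wrong coordinate gets repaired, and since pairs are disjoint only that of [r] ceases to be
   intact. *)
rewrite -addnS; apply: leq_add.
  apply/subset_leq_card/subsetP => k; rewrite !inE.
  by case: (eqVneq k i) => [->//|ki]; rewrite psi'N.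
rewrite -add1n -(cards1 r); apply: leq_trans (leq_card_setU _ _).
apply/subset_leq_card/subsetP => q; rewrite !inE.
case: (eqVneq q r) => //= qr /andP[qS /forallP qP]; rewrite qS.
apply/forallP => k; apply/implyP; have [->|ki] := eqVneq k i; last first.
  by rewrite psi'N //; apply/implyP.
have [rK _ _] := swaps_moved H rS; have [qK _ _] := swaps_moved H qS.
move: kr; rewrite !inE => /orP[]/eqP-> /orP[]/eqP E.
- by rewrite E eqxx in qr.
- by have := swaps_notin H qS; rewrite -E rS.
- by have := swaps_notin H rS; rewrite E qS.
- by rewrite -qK -E rK eqxx in qr.
Qed.

(** At the start, [psi = id], all pairs are intact and at least [2 * #|S|] coordinates are wrong; at
    the end no pair is intact. *)
Lemma black_box_swaps_ge (A : finType) (n : nat) (phi : 'I_n -> 'I_n) t S L :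
  (2 <= #|A|)%N -> pendant_swaps phi t S ->
  computable_in (@black_box A n) (manip phi) L -> (3 * #|S| <= L)%N.
Proof.
move=> hA H /(computable_black_boxP _ _ hA)[ps <- psE].
have := @wiring_swaps_ge n phi id t S ps H psE.
have -> : intact phi id S = S.
  apply/setP => r; rewrite inE; case: (r \in S) => //=.
  by apply/forallP => i; rewrite eqxx implybT.
have -> : intact phi phi S = set0.
  apply/setP => r; rewrite !inE; apply/negP => /andP[rS /forallP/(_ r)].
  have [_ + _] := swaps_moved H rS; rewrite !inE eqxx orbT /= eq_sym.
  by move/negPf->.
have -> : [set i | i != phi i] = moved phi by apply/setP => i; rewrite !inE eq_sym.
rewrite cards0 addn0; apply: leq_trans.
by rewrite mulSn addnC leq_add2r (card_moved_swaps H).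
Qed.

(** * Checksum programs *)

Definition update (A : finType) (n : nat) (i : 'I_n) (F : {ffun 'I_n -> A} -> A) :
    transf A n :=
  fun y => [ffun k => if k == i then F y else y k].

Lemma update_instruction (A : finType) (n : nat) (i : 'I_n)
    (F : {ffun 'I_n -> A} -> A) :
  instruction (update i F).
Proof.
rewrite /instruction -(cards1 i); apply/subset_leq_card/subsetP => k.
rewrite !inE; apply: contraR => ki; apply/forallP => y.
by rewrite ffunE (negbTE ki).
Qed.

(** Transports a cyclic group to the bare alphabet, so that checksums make sense. *)
Lemma finType_zmod (A : finType) : (0 < #|A|)%N ->
  exists (V : zmodType) (g : A -> V) (h : V -> A), cancel g h /\ cancel h g.
Proof.
move=> A_gt0; have E : #|A| = #|A|.-1.+1 by rewrite prednK.
exists 'I_(#|A|.-1.+1), (fun a => cast_ord E (enum_rank a)).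
exists (fun v => enum_val (cast_ord (esym E) v)).
by split=> u; rewrite ?cast_ordK ?enum_rankK // enum_valK cast_ordKV.
Qed.

(* [y_t] holds the checksum throughout; swapping the pair of [r] amounts to
   [y_r <- y_(phi r)] followed by recovering [x_r] from the checksum. *)
Lemma program_swaps (A : finType) (n : nat) (phi : 'I_n -> 'I_n) t S :
  (0 < #|A|)%N -> pendant_swaps phi t S ->
  computable_in (@instruction A n) (manip phi) (2 * #|S| + 2)%N.
Proof.
move=> /finType_zmod[V [g [h [gK hK]]]] H.
(* Memory content once the checksum is in [t] and exactly the pairs represented in [U] are
   swapped. *)
pose state (U : {set 'I_n}) (x : {ffun 'I_n -> A}) : {ffun 'I_n -> A} :=
  [ffun i => if i == t then h (\sum_(r in S) g (x r))
    else if (i \in U) || (phi i \in U) then x (phi i) else x i].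
suff [p [size_p p_instr run_p]] : exists p : seq (transf A n),
    [/\ size p = (2 * #|S| + 1)%N, all (@instruction A n) p &
        forall x, run p (state set0 x) = manip phi x].
  exists (update t (fun y => h (\sum_(r in S) g (y r))) :: p); split.
  - by rewrite /= size_p addn1 addn2.
  - by rewrite /= update_instruction.
  - move=> x; rewrite -run_p /run /=; congr foldl.
    by apply/ffunP => i; rewrite !ffunE !inE.
have -> : (2 * #|S| = 2 * #|S :\: set0|)%N by rewrite setD0.
have [c] := ubnP #|S :\: set0|; move: (sub0set S).
elim: c (set0) => // c IHc U US; rewrite ltnS => le_c.
have [/eqP|[r]] := set_0Vmem (S :\: U).
  rewrite setD_eq0 => SU; have {US SU}-> : U = S by apply/eqP; rewrite eqEsubset US.
  exists [:: assign t (phi t)]; split; first by rewrite setDv cards0.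
    by rewrite /= black_box_instruction ?black_box_assign.
  case: H => tS ptS pm pfix K notin fixed.
  move=> x; apply/ffunP => i; rewrite !ffunE /= (negPf pm) pfix (negPf ptS) /=.
  case: (eqVneq i t) => [->//|it]; case: ifP => // /negbT.
  by rewrite negb_or => /andP[iS piS]; rewrite fixed.
rewrite inE => /andP[rU rS].
have [||p [size_p p_instr run_p]] := IHc (r |: U).
- by rewrite subUset sub1set rS.
- apply: leq_trans le_c; apply: proper_card; apply/properP; split.
    by apply: setDS; apply: subsetUr.
  by exists r; rewrite !inE ?rU ?rS ?eqxx.
(* For the other pairs, [x_q] sits at [phi q] if already swapped and at [q] otherwise; subtracting
   these values isolates [x_r]. *)
pose F (y : {ffun 'I_n -> A}) :=
  h (g (y t) - \sum_(q in S | q != r) g (if q \in U then y (phi q) else y q)).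
exists [:: assign r (phi r), update (phi r) F & p]; split.
- rewrite /= size_p (cardsD1 r (S :\: U)) inE rU rS setDDl [U :|: _]setUC.
  by rewrite mulnDr.
- by rewrite /= black_box_instruction ?black_box_assign ?update_instruction.
move=> x; rewrite -run_p /run /=; congr foldl.
have [prK rpr prt] := swaps_moved H rS.
have rt : r != t by apply: contraNneq (pendant_notin H) => <-.
have SNU q : q \in S -> phi q \notin U.
  by move=> qS; apply: contraNN (swaps_notin H qS); apply: (subsetP US).
have stS q : q \in S -> (if q \in U then state U x (phi q) else state U x q) = x q.
  move=> qS; have [qK _ qt] := swaps_moved H qS.
  have q_t : q != t by apply: contraNneq (pendant_notin H) => <-.
  have := SNU q qS; rewrite !ffunE qK (negPf qt) (negPf q_t).
  by case: ifP => qU /negPf ->; rewrite ?qU.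
pose y := assign r (phi r) (state U x).
have yE k : k != r -> y k = state U x k by rewrite ffunE => /negPf ->.
have FE : F y = x r.
  rewrite /F yE 1?eq_sym // [state U x t]ffunE eqxx hK (bigD1 r) //= -[RHS]gK.
  congr h; apply/eqP; rewrite subr_eq; apply/eqP; congr (_ + _).
  apply: eq_bigr => q /andP[qS qr]; rewrite -{1}(stS q qS) !yE //.
  by apply: contraNneq (swaps_notin H qS) => ->.
apply/ffunP => i; rewrite [LHS]ffunE FE [RHS]ffunE.
case: (eqVneq i (phi r)) => [->|ipr]; first by rewrite (negPf prt) prK !inE eqxx orbT.
rewrite ffunE; case: (eqVneq i r) => [->|ir].
  by rewrite (negPf rt) !inE eqxx ffunE (negPf prt) prK (negPf rU) (negPf (SNU r rS)).
rewrite ffunE !inE (negPf ir) /=; case: (eqVneq i t) => // it.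
suff -> : (phi i == r) = false by [].
by apply: contraNF ipr => /eqP <-; rewrite (swapsK H).
Qed.

(** * The extremal family and the sharpness of the constant *)

(** Swaps [i] and [i + m] for [i < m]; [m + m] is fixed and is read by the pendant coordinate
    [ord_max]. *)
Definition pendant_swaps_map (m : nat) (i : 'I_(m + m).+2) : 'I_(m + m).+2 :=
  inord (if i < m then i + m else if i < m + m then i - m else m + m)%N.

Lemma pendant_swaps_mapP (m : nat) :
  pendant_swaps (@pendant_swaps_map m) ord_max [set i : 'I_(m + m).+2 | (i < m)%N].
Proof.
have val_map (i : 'I_(m + m).+2) : pendant_swaps_map i =
    (if i < m then i + m else if i < m + m then i - m else m + m)%N :> nat.
  by rewrite inordK //; have := ltn_ord i; do 2?[case: ifP]; lia.
have it (i : 'I_(m + m).+2) : i != ord_max -> (i <= m + m)%N.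
  by rewrite -val_eqE /=; have := ltn_ord i; lia.
split.
- by rewrite inE /=; lia.
- by rewrite inE val_map /=; do 2?[case: ifP]; lia.
- by rewrite -val_eqE /= val_map /=; do 2?[case: ifP]; lia.
- by apply: val_inj; rewrite /= !val_map /=; do !case: ifP; lia.
- by move=> i /it le_i; apply: val_inj; rewrite /= !val_map; do !case: ifP; lia.
- by move=> r; rewrite !inE val_map => lt_r; do !case: ifP; lia.
- move=> i; rewrite !inE val_map => ge_i + /it le_i.
  by move=> ge_pi; apply: val_inj; rewrite /= val_map; move: ge_pi; do !case: ifP; lia.
Qed.

Lemma card_ord_lt (m n : nat) : (m <= n)%N -> #|[set i : 'I_n | (i < m)%N]| = m.
Proof.
move=> le_mn; have inj : injective (widen_ord le_mn).
  by move=> j k /(congr1 val) jk; apply: val_inj.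
rewrite -[RHS]card_ord -(card_imset _ inj).
apply: eq_card => i; rewrite inE; apply/idP/imsetP => [lt_im|[j _ ->]].
  2: exact: (ltn_ord j).
by exists (Ordinal lt_im) => //; apply: val_inj.
Qed.

Lemma swaps_not_bijective (n : nat) (phi : 'I_n -> 'I_n) t S :
  pendant_swaps phi t S -> ~ bijective phi.
Proof.
move=> H /bij_inj/(_ _ _ (pendant_image_fixed H)) /eqP.
by rewrite (negPf (pendant_moved H)).
Qed.

Lemma ratio_swaps_le (R : realType) (A : finType) (n : nat) (phi : 'I_n -> 'I_n) t S :
  (2 <= #|A|)%N -> pendant_swaps phi t S -> (0 < #|S|)%N ->
  complexity_ratio R A phi <= (2 * #|S| + 2)%:R / (3 * #|S|)%:R.
Proof.
move=> hA H S_gt0.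
have [_ /(_ _ (program_swaps (ltnW hA) H)) le_c] := shortestP (program_swaps (ltnW hA) H).
(* Some black box program exists, so [shortest] is attained and is not the default [0]. *)
have [ps psE _] := short_wiring (not_bijective_nonsurj (swaps_not_bijective H)).
have /shortestP[bb_min _] : computable_in (@black_box A n) (manip phi) (size ps).
  by apply/computable_black_boxP => //; exists ps.
have ge_b := black_box_swaps_ge hA H bb_min.
rewrite /complexity_ratio /procedural_complexity /black_box_complexity.
apply: ler_pM; rewrite ?invr_ge0 ?ler0n ?ler_nat //.
rewrite lef_pV2 ?posrE ?ltr0n ?ler_nat //; last by rewrite muln_gt0.
by apply: leq_trans ge_b; rewrite muln_gt0.
Qed.

Theorem corollary2 (R : realType) (A : finType) (hA : (2 <= #|A|)%N) :
  (forall (n : nat) (phi : 'I_n -> 'I_n),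
     (2 <= n)%N -> ~ bijective phi -> 2%:R / 3%:R < complexity_ratio R A phi) /\
  (forall eps : R, 0 < eps ->
     exists (n : nat) (phi : 'I_n -> 'I_n),
       [/\ (2 <= n)%N, ~ bijective phi &
           complexity_ratio R A phi < 2%:R / 3%:R + eps]).
Proof.
split=> [n phi _|eps eps_gt0]; first exact: ratio_gt_two_thirds.
(* The excess of [(2 * m + 2) / (3 * m)] over [2 / 3] is [2 / (3 * m)], below [eps] once
   [m > eps^-1]; the successor makes [0 < m] evident. *)
pose m := (Num.bound eps^-1).+1.
have H := pendant_swaps_mapP m.
have card_S : #|[set i : 'I_(m + m).+2 | (i < m)%N]| = m by apply: card_ord_lt; lia.
exists (m + m).+2, (@pendant_swaps_map m); split=> //.
  exact: swaps_not_bijective H.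
have := ratio_swaps_le R hA H; rewrite card_S => /(_ isT)/le_lt_trans; apply.
have m_gt0 : 0 < m%:R :> R by rewrite ltr0n.
have : 1 < eps * m%:R.
  rewrite mulrC -ltr_pdivrMr // div1r; apply: lt_le_trans (archi_boundP _) _.
    by rewrite invr_ge0 ltW.
  by rewrite ler_nat.
rewrite natrD !natrM ltr_pdivrMr ?mulr_gt0 ?ltr0n //; lra.
Qed.
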